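(* Let $n\ge1$ be fixed, $\beta\in[0,1]$, and, for each dimension $d$, let $X_1,\ldots,X_n$ be a random sample (i.i.d.) from $N(0,\Sigma_d)$, where $\Sigma_d$ has eigenvalues $\lambda_1\ge\cdots\ge\lambda_d$ with orthonormal eigenvectors $u_1,\ldots,u_d$. Suppose that $u_1=(u_{1,1},\ldots,u_{d,1})^T$ with $u_{i,1}\neq0$ for $i=1,\ldots,\lfloor d^\beta\rfloor$ and $u_{i,1}=0$ otherwise. Suppose that: (a) $\lambda_1\sim d^\alpha$, $\lambda_2\sim d^\theta$ and $\sum_{i=2}^d\lambda_i\sim d$, where $\theta\in[0,\alpha)$ and $\alpha\in(0,1]$; (b) for a non-negative constant $C$, $\limsup_{d\to\infty}\frac{\lambda_1}{\sum_{i=2}^d\lambda_i}=C$, and $\frac{\sum_{i=1}^d\lambda_i^2}{(\sum_{i=1}^d\lambda_i)^2}\to0$ as $d\to\infty$; (c) $\max_{1\le i\le\lfloor d^\beta\rfloor}|u_{i,1}|^{-1}\sim d^{\eta/2}$, where $\eta\in[0,\alpha)$; (d) the vectors $H_j=\sum_{i=2}^d(X_j^Tu_i)u_i$, $j=1,\ldots,n$, which are i.i.d. $N(0,\Delta_d)$ with $\Delta_d=(m_{kl})_{d\times d}$, satisfy the mixing condition $$|m_{kl}|\le m_{kk}^{1/2}m_{ll}^{1/2}\rho_{|k-l|},\qquad 1\le k\ne l\le\lfloor d^\beta\rfloor,$$ where $\rho_t<1$ for all $t>1$ and $\rho_t\log t\to0$ as $t\to\infty$; (e) the thresholding parameter $\lambda=\lambda(d)$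 satisfies $(\log d)^\delta\,d^{\theta/2}\le\lambda\le d^{\gamma/2}$ for all sufficiently large $d$, where $\delta\in(\frac12,\infty)$ and $\gamma\in(\theta,\alpha-\eta)$. Let $h_\lambda$ be the soft thresholding, hard thresholding or SCAD thresholding function, and let $\hat u_1^{\rm old}=h_\lambda(X_{(d)}\tilde v_1)/\|h_\lambda(X_{(d)}\tilde v_1)\|$ be the sparse loading vector obtained after the first iteration of the RSPCA algorithm. Assume that $\hat u_1^{\rm old}$ is consistent with $u_1$ with convergence rate $d^{\varsigma/2}$, i.e. $|\langle\hat u_1^{\rm old},u_1\rangle|=1+o_p(d^{-\varsigma/2})$, where $\varsigma\in[1-\alpha,\infty)$. Let $\tilde v_1^{\rm new}=X_{(d)}^T\hat u_1^{\rm old}/\|X_{(d)}^T\hat u_1^{\rm old}\|$. Then the updated sparse loading vector $$\hat u_1^{\rm new}=\frac{\tilde u_1^{\rm new}}{\|\tilde u_1^{\rm new}\|},\qquad \tilde u_1^{\rm new}=h_\lambda(X_{(d)}\tilde v_1^{\rm new}),$$ is consistent with $u_1$, i.e. $\arccos(|\langle\hat u_1^{\rm new},u_1\rangle|)\to0$ in probability as $d\to\infty$.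
   Context: All quantities are indexed by $d$; $n$ is fixed and $d\to\infty$. The symbols $\lambda_i$ with an index are eigenvalues of $\Sigma_d$; $\lambda$ without an index is the thresholding parameter (the same at every step of the algorithm). The sequence $(\rho_t)_{t\ge1}$ does not depend on $d$. Notation: $a_d\sim b_d$ means there are constants $0<c_1\le c_2<\infty$ with $c_1\le\liminf_{d\to\infty} a_d/b_d\le\limsup_{d\to\infty} a_d/b_d\le c_2$. $G_d=o_p(d^{-\iota})$ means $d^\iota G_d\to0$ in probability as $d\to\infty$. RSPCA: $X_{(d)}=[X_1,\ldots,X_n]$ is the $d\times n$ data matrix, $\tilde v_1\in\mathbb R^n$ is the unit vector in the best rank-one approximation (in Frobenius norm) $\tilde u_1\tilde v_1^T$ of $X_{(d)}$ given by the SVD, i.e. a unit eigenvector of $X_{(d)}^TX_{(d)}$ for its largest eigenvalue. The thresholding function $h_\lambda$ is applied componentwise; the normalization of a zero vector is taken to be the zero vector. The thresholding functions are: hard, $h_\lambda(y)=y\,1_{\{|y|>\lambda\}}$; soft, $h_\lambda(y)={\rm sign}(y)(|y|-\lambda)_+$; SCAD (with a fixed constant $a>2$), $h_\lambda(y)={\rm sign}(y)(|y|-\lambda)_+$ if $|y|\le2\lambda$, $h_\lambda(y)=\frac{(a-1)y-{\rm sign}(y)a\lambda}{a-2}$ if $2\lambda<|y|\le a\lambda$, and $h_\lambda(y)=y$ if $|y|>a\lambda$. *)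

(* Defs.v *)
From HB Require Import structures.
From mathcomp Require Import all_boot all_order all_algebra.
From mathcomp Require Import all_classical all_reals all_analysis.
Set Implicit Arguments.
Unset Strict Implicit.
Unset Printing Implicit Defensive.
Import Order.TTheory GRing.Theory Num.Theory.
Import numFieldNormedType.Exports.
Local Open Scope classical_set_scope.
Local Open Scope ring_scope.

(* The library norm on matrices is the sup norm; the Euclidean one is needed. *)
Definition dotv (R : realType) (d : nat) (x y : 'cV[R]_d) : R :=
  \sum_(i < d) x i 0 * y i 0.

Definition norm2 (R : realType) (d : nat) (x : 'cV[R]_d) : R :=
  Num.sqrt (dotv x x).

(* Since 0^-1 = 0, the zero vector is normalized to the zero vector. *)
Definition normalize (R : realType) (d : nat) (x : 'cV[R]_d) : 'cV[R]_d :=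
  (norm2 x)^-1 *: x.

(* a_d ~ b_d; liminf and limsup are taken in the extended reals. *)
Definition same_order (R : realType) (a b : nat -> R) : Prop :=
  exists c1 c2 : R, [/\ 0 < c1, c1 <= c2,
    (c1%:E <= limn_einf (fun d => (a d / b d)%:E))%E &
    (limn_esup (fun d => (a d / b d)%:E) <= c2%:E)%E].

Definition cvg_in_prob (R : realType) (disp : nat -> measure_display)
    (T : forall d, measurableType (disp d)) (P : forall d, probability (T d) R)
    (Y : forall d, T d -> R) (l : R) : Prop :=
  forall e : R, 0 < e ->
    (fun d => P d [set w | e <= `|Y d w - l|]) @ \oo --> 0%E.

Definition little_op (R : realType) (disp : nat -> measure_display)
    (T : forall d, measurableType (disp d)) (P : forall d, probability (T d) R)
    (iota : R) (G : forall d, T d -> R) : Prop :=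
  cvg_in_prob P (fun d w => d%:R `^ iota * G d w) 0.

Definition random_vector (R : realType) (disp : measure_display)
    (T : measurableType disp) (d : nat) (Y : T -> 'cV[R]_d) : Prop :=
  forall i : 'I_d, measurable_fun setT (fun w => Y w i 0).

(* N(m, s^2) on the line.  The case s = 0 is separate because the library's
   [normal_prob m 0] is by convention the uniform law on [0, 1]. *)
Definition gauss_law (R : realType) (m s : R) (B : set R) : \bar R :=
  if s == 0 then \d_m B else normal_prob m s B.

(* Y ~ N(mu, S), with S positive semidefinite and possibly singular: every
   linear functional <a, Y> has law N(<a, mu>, a^T S a). *)
Definition mvnormal (R : realType) (disp : measure_display)
    (T : measurableType disp) (P : probability T R) (d : nat)
    (Y : T -> 'cV[R]_d) (mu : 'cV[R]_d) (S : 'M[R]_d) : Prop :=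
  [/\ random_vector Y,
      S^T = S,
      forall a : 'cV[R]_d, 0 <= dotv a (S *m a) &
      forall (a : 'cV[R]_d) (B : set R), measurable B ->
        P ((fun w => dotv a (Y w)) @^-1` B) =
        gauss_law (dotv a mu) (Num.sqrt (dotv a (S *m a))) B].

(* Mutual independence of the sigma-algebras generated by the coordinates of
   the Y j.  Product rules for subfamilies are the instances where some of the
   A j are the whole space. *)
Definition independent_vectors (R : realType) (disp : measure_display)
    (T : measurableType disp) (P : probability T R) (n d : nat)
    (Y : 'I_n -> T -> 'cV[R]_d) : Prop :=
  forall A : 'I_n -> set T,
    (forall j, g_sigma_preimage (fun (i : 'I_d) (w : T) => Y j w i 0) (A j)) ->
    P (\bigcap_j A j) = (\prod_(j < n) P (A j))%E.

Definition iid_mvnormal (R : realType) (disp : measure_display)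
    (T : measurableType disp) (P : probability T R) (n d : nat)
    (Y : 'I_n -> T -> 'cV[R]_d) (mu : 'cV[R]_d) (S : 'M[R]_d) : Prop :=
  (forall j, mvnormal P (Y j) mu S) /\ independent_vectors P Y.

(* Eigenvalues and eigenvectors are numbered from 1 to d, as in
   lambda_1 >= ... >= lambda_d; other indices are not constrained. *)
Definition ordered_eigensystem (R : realType) (d : nat) (S : 'M[R]_d)
    (lam : nat -> R) (u : nat -> 'cV[R]_d) : Prop :=
  [/\ forall i j : nat, (1 <= i <= j)%N -> (j <= d)%N -> lam j <= lam i,
      forall i : nat, (1 <= i <= d)%N -> S *m u i = lam i *: u i &
      forall i j : nat, (1 <= i <= d)%N -> (1 <= j <= d)%N ->
        dotv (u i) (u j) = (i == j)%:R].

Definition supp_size (R : realType) (beta : R) (d : nat) : nat :=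
  Num.truncn (d%:R `^ beta).

(* H_j = sum_{i=2}^d (X_j^T u_i) u_i, where X_j is the j-th column of X. *)
Definition noise_part (R : realType) (d n : nat) (u : nat -> 'cV[R]_d)
    (X : 'M[R]_(d, n)) (j : 'I_n) : 'cV[R]_d :=
  \sum_(2 <= i < d.+1) dotv (col j X) (u i) *: u i.

(* First argument: the threshold lambda. *)
Definition hard_thr (R : realType) (lambda y : R) : R :=
  if lambda < `|y| then y else 0.

Definition soft_thr (R : realType) (lambda y : R) : R :=
  Num.sg y * Num.max (`|y| - lambda) 0.

Definition scad_thr (R : realType) (a lambda y : R) : R :=
  if `|y| <= 2 * lambda then Num.sg y * Num.max (`|y| - lambda) 0
  else if `|y| <= a * lambda then
    ((a - 1) * y - Num.sg y * a * lambda) / (a - 2)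
  else y.

Definition thresholding (R : realType) (h : R -> R -> R) : Prop :=
  [\/ h = @soft_thr R, h = @hard_thr R | exists2 a : R, 2 < a & h = scad_thr a].

Definition top_right_singular_vector (R : realType) (d n : nat)
    (X : 'M[R]_(d, n)) (v : 'cV[R]_n) : Prop :=
  norm2 v = 1 /\
  exists2 mu : R, (X^T *m X) *m v = mu *: v &
    forall nu : R, eigenvalue (X^T *m X) nu -> nu <= mu.

Definition rspca_loading (R : realType) (h : R -> R -> R) (lambda : R)
    (d n : nat) (X : 'M[R]_(d, n)) (v : 'cV[R]_n) : 'cV[R]_d :=
  normalize (map_mx (h lambda) (X *m v)).

Definition rspca_score (R : realType) (d n : nat) (X : 'M[R]_(d, n))
    (u : 'cV[R]_d) : 'cV[R]_n :=
  normalize (X^T *m u).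

(* Main.v *)
Require Import Defs.
From HB Require Import structures.
From mathcomp Require Import all_boot all_order all_algebra.
From mathcomp Require Import all_classical all_reals all_analysis.
From mathcomp Require Import measurable_realfun ring lra.
Import Order.TTheory GRing.Theory Num.Theory.
Import numFieldNormedType.Exports.
Set Implicit Arguments.
Unset Strict Implicit.
Unset Printing Implicit Defensive.
Local Open Scope classical_set_scope.
Local Open Scope ring_scope.

(** Split each observation as [X_j = z_j u_1 + H_j], where [z_j = <X_j, u_1>]
    and [H_j] is orthogonal to [u_1].

    Noise.  Every coordinate of [H_j] is a centred Gaussian of variance at most
    [lambda_2 = O(d^theta)].  As [lambda >= (ln d)^delta d^(theta/2)] with
    [2 delta > 1], the Gaussian tail beats the number [n d] of coordinates, and
    with probability tending to one all of them are at most [lambda / n]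
    ([residual_tail], [near_union_tail_le]).  On this event, for every [v] of
    norm at most one, [X v] differs from [<z, v> u_1] by at most [lambda] in
    each coordinate ([signal_noise]).

    Loading.  Coordinates of [X v] outside the support of [u_1] are therefore
    thresholded to zero, and on the support thresholding adds an error of at
    most [lambda].  Let [K = O(d^(eta/2))] bound [1 / |u_(i,1)|] on the support.
    The total error [2 lambda] in coordinate [i] is at most
    [2 lambda K |u_(i,1)|], so the thresholded vector lies within [2 lambda K]
    of [<z, v> u_1] in Euclidean norm.  Its direction is that of [u_1] as soon
    as [|<z, v>|] is large compared with [lambda K = O(d^((gamma+eta)/2))]
    ([loading_cos]).

    Score.  It remains to see that the updated score [v] satisfies this.  The
    old loading [p] vanishes off the support of [u_1], so
    [X^T p = <p, u_1> z + H^T p], where the same comparison with [u_1] and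
    Cauchy-Schwarz give
    [|(H^T p)_j| <= lambda / n * K * sum_i |p_i| |u_(i,1)| <= lambda K / n]
    ([score_near]).  Consistency of [p] keeps [|<p, u_1>|] above [1/2], and one
    [z_j], of standard deviation at least of order [d^(alpha/2)], already
    exceeds any multiple of [lambda K] with probability tending to one, because
    [gamma + eta < alpha] ([signal_ball], [score_signal]). *)

(** * Euclidean geometry of column vectors *)

Section Euclidean.
Variables (R : realType) (d : nat).
Implicit Types x y z : 'cV[R]_d.

Lemma dotvC x y : dotv x y = dotv y x.
Proof. by apply: eq_bigr => i _; rewrite mulrC. Qed.

Lemma dotvDl x y z : dotv (x + y) z = dotv x z + dotv y z.
Proof. by rewrite -big_split; apply: eq_bigr => i _; rewrite mxE mulrDl. Qed.

Lemma dotvZl a x z : dotv (a *: x) z = a * dotv x z.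
Proof. by rewrite mulr_sumr; apply: eq_bigr => i _; rewrite mxE mulrA. Qed.

Lemma dotvBl x y z : dotv (x - y) z = dotv x z - dotv y z.
Proof. by rewrite -scaleN1r dotvDl dotvZl mulN1r. Qed.

Lemma dotvBr x y z : dotv z (x - y) = dotv z x - dotv z y.
Proof. by rewrite ![dotv z _]dotvC dotvBl. Qed.

Lemma dotvZr a x z : dotv z (a *: x) = a * dotv z x.
Proof. by rewrite ![dotv z _]dotvC dotvZl. Qed.

Lemma dotv_ge0 x : 0 <= dotv x x.
Proof. by apply: sumr_ge0 => i _; rewrite -expr2 sqr_ge0. Qed.

Lemma norm2_ge0 x : 0 <= norm2 x. Proof. exact: sqrtr_ge0. Qed.

Lemma sqr_norm2 x : norm2 x ^+ 2 = dotv x x.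
Proof. by rewrite sqr_sqrtr // dotv_ge0. Qed.

Lemma norm_coord_le x i : `|x i 0| <= norm2 x.
Proof.
rewrite -(@ler_pXn2r _ 2) ?nnegrE ?norm2_ge0 ?normr_ge0 // sqr_norm2.
rewrite real_normK ?num_real // /dotv (bigD1 i) //= -expr2 lerDl.
by apply: sumr_ge0 => k _; rewrite -expr2 sqr_ge0.
Qed.

Lemma norm2_eq0 x : norm2 x = 0 -> x = 0.
Proof.
move=> x0; apply/colP => i; rewrite mxE; apply/eqP.
by rewrite -normr_le0 -x0 norm_coord_le.
Qed.

Lemma cauchy_schwarz x y : `|dotv x y| <= norm2 x * norm2 y.
Proof.
have [y0|yN0] := eqVneq (norm2 y) 0.
  rewrite y0 (norm2_eq0 y0) -(scale0r 0) dotvC dotvZl mul0r normr0 mulr0.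
  exact: lexx.
have yy0 : 0 < dotv y y by rewrite -sqr_norm2 exprn_even_gt0.
rewrite -(@ler_pXn2r _ 2) ?nnegrE ?mulr_ge0 ?norm2_ge0 ?normr_ge0 //.
rewrite real_normK ?num_real // exprMn !sqr_norm2 -subr_ge0.
(* the squared length of the component of [x] orthogonal to [y], rescaled *)
have := dotv_ge0 (dotv y y *: x - dotv x y *: y).
rewrite !(dotvBl, dotvBr, dotvZl, dotvZr) (dotvC y x).
set a := dotv x x; set b := dotv x y; set c := dotv y y.
have -> : c * (c * a - b * b) - b * (c * b - b * c) = c * (a * c - b ^+ 2).
  by ring.
by rewrite pmulr_rge0.
Qed.

Lemma norm2D x y : norm2 (x + y) <= norm2 x + norm2 y.
Proof.
rewrite -(@ler_pXn2r _ 2) ?nnegrE ?addr_ge0 ?norm2_ge0 // sqr_norm2.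
rewrite dotvDl ![dotv _ (x + y)]dotvC !dotvDl -!sqr_norm2 (dotvC y x).
have := le_trans (ler_norm _) (cauchy_schwarz x y).
by rewrite sqrrD; lra.
Qed.

Lemma norm2Z a x : norm2 (a *: x) = `|a| * norm2 x.
Proof.
by rewrite /norm2 dotvZl dotvZr mulrA -expr2 sqrtrM ?sqr_ge0 // sqrtr_sqr.
Qed.

(** Cauchy-Schwarz for the vectors of absolute values. *)
Lemma sum_norm_le x y :
  \sum_i `|x i 0| * `|y i 0| <= norm2 x * norm2 y.
Proof.
have norm2_abs z : norm2 (map_mx Num.norm z) = norm2 z.
  congr Num.sqrt; apply: eq_bigr => i _.
  by rewrite mxE -normrM -expr2 ger0_norm ?sqr_ge0.
rewrite -(norm2_abs x) -(norm2_abs y); apply: le_trans (cauchy_schwarz _ _).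
apply: le_trans (ler_norm _); rewrite le_eqVlt; apply/orP; left; apply/eqP.
by apply: eq_bigr => i _; rewrite !mxE.
Qed.

Lemma norm2_le_pointwise c x y :
  0 <= c -> (forall i, `|x i 0| <= c * `|y i 0|) -> norm2 x <= c * norm2 y.
Proof.
move=> c0 xy; rewrite -[c]ger0_norm // -norm2Z ler_wsqrtr //.
apply: ler_sum => i _; rewrite !mxE -!expr2 -(real_normK (num_real (x i 0))).
rewrite -(real_normK (num_real (c * _))) ler_pXn2r ?nnegrE ?normr_ge0 //.
by rewrite normrM (ger0_norm c0).
Qed.

Lemma norm2_normalize x : x != 0 -> norm2 (normalize x) = 1.
Proof.
move=> x0; rewrite norm2Z ger0_norm ?invr_ge0 ?norm2_ge0 // mulVf //.
by apply: contra_neq x0 => /norm2_eq0.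
Qed.

Lemma norm2_normalize_le1 x : norm2 (normalize x) <= 1.
Proof.
have [->|x0] := eqVneq x 0; last by rewrite norm2_normalize.
rewrite /normalize scaler0; suff -> : norm2 (0 : 'cV[R]_d) = 0 by exact: ler01.
by rewrite -[X in norm2 X](scale0r 0) norm2Z normr0 mul0r.
Qed.

End Euclidean.

(** * Thresholding functions *)

Section Thresholding.
Variable R : realType.
Implicit Types (h : R -> R -> R) (l y : R).

(** This lemma and [thr_dist] are the only features of the three thresholding
    functions that matter for consistency. *)
Lemma thr_eq0 h l y : thresholding h -> 0 <= l -> `|y| <= l -> h l y = 0.
Proof.
move=> hh l0 yl.
have soft0 : Num.sg y * Num.max (`|y| - l) 0 = 0.
  by rewrite max_r ?mulr0 // subr_le0.
case: hh => [->|->|[a a2 ->]] //; first by rewrite /hard_thr ltNge yl.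
by rewrite /scad_thr (le_trans yl) //; lra.
Qed.

Lemma thr_dist h l y : thresholding h -> 0 <= l -> `|h l y - y| <= l.
Proof.
move=> hh l0.
have soft_dist : `|Num.sg y * Num.max (`|y| - l) 0 - y| <= l.
  have [yl|ly] := leP `|y| l.
    by rewrite max_r ?subr_le0 // mulr0 sub0r normrN.
  rewrite max_l; last by rewrite subr_ge0 ltW.
  rewrite {3}(numEsg y) mulrBr addrAC subrr sub0r normrN normrM normr_sg.
  by case: (y == 0); rewrite ?mul0r ?mul1r ?ger0_norm.
case: hh => [->|->|[a a2 ->]] //.
  rewrite /hard_thr; case: ltP => yl; first by rewrite subrr normr0.
  by rewrite sub0r normrN.
rewrite /scad_thr; case: (leP `|y| (2 * l)) => // y2l.
case: (leP `|y| (a * l)) => yal; last by rewrite subrr normr0.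
(* on its middle piece SCAD interpolates linearly between soft and hard *)
have -> : ((a - 1) * y - Num.sg y * a * l) / (a - 2) - y
          = Num.sg y * ((`|y| - a * l) / (a - 2)).
  by rewrite {1 3}(numEsg y); field; lra.
rewrite normrM normr_sg normf_div (ler0_norm (x := _ - _)); last by lra.
rewrite [`|a - 2|]ger0_norm; last by lra.
have : - (`|y| - a * l) / (a - 2) <= l by rewrite ler_pdivrMr; lra.
by case: (y == 0) => yl; rewrite ?mul0r ?mul1r.
Qed.

Lemma measurable_thr h l : thresholding h -> measurable_fun setT (h l).
Proof.
have msg : measurable_fun setT (@Num.sg R).
  rewrite [X in measurable_fun _ X](_ : _ =
      fun y : R => if 0 < y then 1 else if y < 0 then -1 else 0); last first.
    by apply/funext => y /=; case: sgrP.
  by apply: measurable_fun_ifT => //;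
    [apply: measurable_fun_ltr|apply: measurable_fun_ifT => //;
     apply: measurable_fun_ltr].
have msoft : measurable_fun setT (@soft_thr R l).
  apply: measurable_funM => //; apply: measurable_maxr => //.
  by apply: measurable_funB.
case=> [->|->|[a a2 ->]] //.
  by apply: measurable_fun_ifT => //; apply: measurable_fun_ltr.
apply: measurable_fun_ifT => //; first exact: measurable_fun_ler.
apply: measurable_fun_ifT => //; first exact: measurable_fun_ler.
apply: measurable_funM => //; apply: measurable_funB => //.
by apply: measurable_funM => //; apply: measurable_funM.
Qed.

End Thresholding.

(** * Spectral decomposition of the covariance *)

Section Spectral.
Variables (R : realType) (d : nat) (S : 'M[R]_d).
Variables (lam : nat -> R) (u : nat -> 'cV[R]_d).
Hypothesis hS : ordered_eigensystem S lam u.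

Lemma dotv_sumr (I : Type) (r : seq I) (x : 'cV[R]_d) (f : I -> 'cV[R]_d) :
  dotv x (\sum_(k <- r) f k) = \sum_(k <- r) dotv x (f k).
Proof.
elim/big_rec2: _ => [|k a v _ <-].
  by rewrite -(scale0r 0) dotvZr mul0r.
by rewrite dotvC dotvDl !(dotvC x).
Qed.

(** The square matrix [U] of eigenvectors has [U^T U = 1], hence [U U^T = 1]. *)
Lemma eigenbasis_expansion (b : 'cV[R]_d) :
  b = \sum_(k < d) dotv b (u k.+1) *: u k.+1.
Proof.
have [_ _ ortho] := hS.
pose U : 'M[R]_d := \matrix_(i, k) u k.+1 i 0.
have UU : U^T *m U = 1%:M.
  apply/matrixP => k l; rewrite !mxE -(ortho k.+1 l.+1) ?ltn_ord //.
  by apply: eq_bigr => i _; rewrite !mxE.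
rewrite -[LHS](mul1mx b) -(mulmx1C UU) -mulmxA.
apply/colP => i; rewrite mxE summxE; apply: eq_bigr => k _.
rewrite !mxE mulrC; congr (_ * _).
by apply: eq_bigr => j _; rewrite !mxE mulrC.
Qed.

Lemma parseval (b : 'cV[R]_d) : dotv b b = \sum_(k < d) dotv b (u k.+1) ^+ 2.
Proof.
rewrite {2}(eigenbasis_expansion b) dotv_sumr.
by apply: eq_bigr => k _; rewrite dotvZr expr2.
Qed.

Lemma quadratic_form_eigen (b : 'cV[R]_d) :
  dotv b (S *m b) = \sum_(k < d) lam k.+1 * dotv b (u k.+1) ^+ 2.
Proof.
have [_ eigen _] := hS.
rewrite {2}(eigenbasis_expansion b) mulmx_sumr dotv_sumr.
apply: eq_bigr => k _; rewrite -scalemxAr eigen ?ltn_ord // !dotvZr.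
by rewrite expr2 mulrCA.
Qed.

(** Orthogonality to the first eigenvector removes the spike [lam 1], and all the
    other eigenvalues are at most [lam 2]. *)
Lemma quadratic_form_orth_le (b : 'cV[R]_d) (m : R) :
  dotv b (u 1) = 0 -> dotv b b <= 1 -> 0 <= m -> lam 2 <= m ->
  dotv b (S *m b) <= m.
Proof.
move=> bu1 b1 m0 lam2m; have [lam_le _ _] := hS.
rewrite quadratic_form_eigen.
apply: (@le_trans _ _ (m * dotv b b)); last by rewrite ler_piMr.
rewrite parseval mulr_sumr; apply: ler_sum => -[[|k] kd] _ /=.
  by rewrite bu1 expr0n !mulr0.
by rewrite ler_wpM2r ?sqr_ge0 // (le_trans _ lam2m) // lam_le.
Qed.

Lemma norm2_eigenvector1 : (0 < d)%N -> norm2 (u 1) = 1.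
Proof.
by move=> d0; have [_ _ ortho] := hS; rewrite /norm2 ortho ?d0 // sqrtr1.
Qed.

End Spectral.

(** * Thresholded loadings under bounded noise *)

(** For a unit vector [u], this is coordinate [i] of the component of [Y]
    orthogonal to [u]. *)
Definition residual (R : realType) (d : nat) (u Y : 'cV[R]_d) (i : 'I_d) : R :=
  Y i 0 - u i 0 * dotv Y u.

Section Deterministic.
Variables (R : realType) (d n : nat) (h : R -> R -> R) (lambda K : R).
Variables (X : 'M[R]_(d, n)) (u : 'cV[R]_d) (S : pred 'I_d).
Hypotheses (hh : thresholding h) (lambda0 : 0 < lambda) (n0 : (0 < n)%N).
Hypotheses (u1 : norm2 u = 1).
Hypotheses (u_off : forall i, ~~ S i -> u i 0 = 0).
Hypotheses (u_on : forall i, S i -> 1 <= K * `|u i 0|) (K0 : 0 < K).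
Hypothesis noise :
  forall i j, `|residual u (col j X) i| <= lambda / n%:R.

Let z (v : 'cV[R]_n) : R := \sum_j dotv (col j X) u * v j 0.

Lemma norm_sum_noise_le (v : 'cV[R]_n) i : norm2 v <= 1 ->
  `|\sum_j residual u (col j X) i * v j 0| <= lambda.
Proof.
move=> v1; apply: le_trans (ler_norm_sum _ _ _) _.
apply: (@le_trans _ _ (\sum_(j < n) lambda / n%:R)).
  apply: ler_sum => j _; rewrite normrM.
  apply: le_trans (noise i j).
  by rewrite ler_piMr // (le_trans (norm_coord_le _ _)).
rewrite sumr_const card_ord -[_ *+ n]mulr_natr mulfVK //.
by rewrite pnatr_eq0 -lt0n.
Qed.

Lemma signal_noise (v : 'cV[R]_n) i : norm2 v <= 1 ->
  `|(X *m v) i 0 - u i 0 * z v| <= lambda.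
Proof.
move=> v1; apply: le_trans (norm_sum_noise_le i v1).
rewrite le_eqVlt; apply/orP; left; apply/eqP; congr (`| _ |).
rewrite mxE /z mulr_sumr -sumrB; apply: eq_bigr => j _.
by rewrite /residual !mxE; ring.
Qed.

Lemma thr_off_support (v : 'cV[R]_n) i : norm2 v <= 1 -> ~~ S i ->
  h lambda ((X *m v) i 0) = 0.
Proof.
move=> v1 Si; apply: (thr_eq0 hh (ltW lambda0)).
by have := signal_noise i v1; rewrite u_off // mul0r subr0.
Qed.

(** Bounding [sum_i |p_i|] by [K * sum_i |p_i| |u_i|] replaces the square root of
    the support size by [K], whose order is controlled. *)
Lemma score_near (p : 'cV[R]_d) j : norm2 p <= 1 ->
  (forall i, ~~ S i -> p i 0 = 0) ->
  `|(X^T *m p) j 0 - dotv p u * dotv (col j X) u| <= lambda / n%:R * K.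
Proof.
move=> p1 p_off.
have -> : (X^T *m p) j 0 - dotv p u * dotv (col j X) u
          = \sum_i residual u (col j X) i * p i 0.
  rewrite mxE mulr_suml -sumrB; apply: eq_bigr => i _.
  by rewrite /residual !mxE; ring.
apply: le_trans (ler_norm_sum _ _ _) _.
have t0 : 0 <= lambda / n%:R by rewrite divr_ge0 ?ler0n // ltW.
apply: (@le_trans _ _ (\sum_i lambda / n%:R * K * (`|p i 0| * `|u i 0|))).
  apply: ler_sum => i _; rewrite normrM.
  case Si : (S i); last by rewrite p_off ?Si // normr0 mulr0 mul0r mulr0.
  apply: le_trans (ler_wpM2r (normr_ge0 _) (noise i j)) _.
  rewrite -mulrA ler_wpM2l // mulrCA ler_peMr //.
  exact: u_on.
rewrite -mulr_sumr ler_piMr ?(mulr_ge0 t0 (ltW K0)) //.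
apply: le_trans (sum_norm_le _ _) _.
by rewrite u1 mulr1.
Qed.

(** Let [w = X^T p = c z + g] with [c = <p, u>] and [g] the contribution of the
    noise, and [v = w / |w|].  Pairing with [v] gives
    [c <z, v> = |w| - <g, v>], and coordinate [j] bounds [|w|] from below. *)
Lemma score_signal (p : 'cV[R]_d) j : norm2 p <= 1 ->
  (forall i, ~~ S i -> p i 0 = 0) -> 1 / 2 <= `|dotv p u| ->
  4 * (lambda * K) < `|dotv (col j X) u| ->
  norm2 (rspca_score X p) = 1 /\
  `|dotv (col j X) u| / 2 - 2 * (lambda * K) <= `|z (rspca_score X p)|.
Proof.
move=> p1 p_off c_ge z_gt.
set L := lambda * K in z_gt *; set zj := dotv (col j X) u in z_gt *.
have tK : lambda / n%:R * K <= L.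
  rewrite ler_wpM2r ?(ltW K0) // ler_pdivrMr ?ltr0n // ler_peMr ?ler1n //.
  exact: ltW.
have L0 : 0 <= L by rewrite mulr_ge0 // ltW.
set w := X^T *m p; set c := dotv p u in c_ge *.
have c_le : `|c| <= 1.
  by apply: le_trans (cauchy_schwarz _ _) _; rewrite u1 mulr1.
have wj : `|zj| / 2 - L <= `|w j 0|.
  have := le_trans (score_near j p1 p_off) tK; rewrite -/w -/c -/zj => wcz.
  have : `|c * zj| <= `|w j 0| + `|w j 0 - c * zj|.
    by rewrite -[X in `|X| <= _](subKr (w j 0)) ler_normB.
  rewrite normrM; have : `|zj| / 2 <= `|c| * `|zj|.
    by rewrite mulrC ler_wpM2r // -div1r.
  by lra.
have w_gt0 : 0 < norm2 w by apply: lt_le_trans (norm_coord_le _ j); lra.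
have w0 : w != 0.
  by apply: contraTneq w_gt0 => ->; rewrite /norm2 -[X in dotv X](scale0r 0)
     dotvZl mul0r sqrtr0 ltxx.
rewrite /rspca_score -/w.
set v := normalize w; have v1 : norm2 v = 1 by exact: norm2_normalize.
split => //.
have wv : dotv w v = norm2 w.
  by rewrite dotvZr -sqr_norm2 expr2 mulKf // gt_eqF.
have noise_v : `|dotv w v - c * z v| <= L.
  have -> : dotv w v - c * z v
            = \sum_j' (w j' 0 - c * dotv (col j' X) u) * v j' 0.
    rewrite mulr_sumr -sumrB; apply: eq_bigr => j' _; ring.
  apply: le_trans (ler_norm_sum _ _ _) _.
  apply: (@le_trans _ _ (\sum_(j' < n) lambda / n%:R * K)).
    apply: ler_sum => j' _; rewrite normrM.
    apply: le_trans (score_near j' p1 p_off).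
    by rewrite ler_piMr // -v1 norm_coord_le.
  rewrite sumr_const card_ord -[_ *+ n]mulr_natr mulrAC mulfVK //.
  by rewrite pnatr_eq0 -lt0n.
have cz : `|c * z v| <= `|z v| by rewrite normrM ler_piMl.
have := ler_norm (c * z v); rewrite wv in noise_v.
move: noise_v; rewrite ler_norml => /andP[_].
by have := norm_coord_le w j; lra.
Qed.

(** A vector [w] within [2 L] of [q u], with [u] of norm one, satisfies
    [|<w, u>| >= |q| - 2 L] and [|w| <= |q| + 2 L]; the ratio is at least
    [1 - 4 / M] once [|q| + 2 L >= M L].  The distance [2 L] combines the noise
    and the thresholding error, each at most [lambda] in a coordinate of the
    support, and [1 <= K |u_i|] there. *)
Lemma loading_cos (v : 'cV[R]_n) (M : R) : norm2 v <= 1 -> 4 < M ->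
  (M - 2) * (lambda * K) <= `|z v| ->
  1 - 4 / M <= `|dotv (rspca_loading h lambda X v) u|.
Proof.
move=> v1 M4 zv; set L := lambda * K in zv *.
have L0 : 0 < L by rewrite mulr_gt0.
rewrite /rspca_loading; set w := map_mx _ _; set q := z v in zv *.
have w_near : norm2 (w - q *: u) <= 2 * L.
  have := @norm2_le_pointwise _ _ (2 * L) (w - q *: u) u.
  rewrite u1 mulr1; apply; first by lra.
  move=> i; rewrite !mxE.
  have [Si|Si] := boolP (S i); last first.
    have := thr_off_support v1 Si; rewrite mxE => ->.
    by rewrite u_off // mulr0 subrr normr0 mulr0.
  set y := \sum_j _; have yE : y = (X *m v) i 0 by rewrite mxE.
  have := signal_noise i v1; rewrite -yE -/q => yq.
  have hy := thr_dist y hh (ltW lambda0).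
  apply: (@le_trans _ _ (2 * lambda)).
    rewrite (_ : _ - _ = (h lambda y - y) + (y - u i 0 * q)); last by ring.
    by apply: le_trans (ler_normD _ _) _; lra.
  by rewrite -!mulrA ler_pM2l // -/lambda ler_peMr ?u_on // ltW.
have wE : w = q *: u + (w - q *: u) by rewrite addrC subrK.
have wu : `|q| - 2 * L <= `|dotv w u|.
  have : `|dotv (w - q *: u) u| <= 2 * L.
    by apply: le_trans (cauchy_schwarz _ _) _; rewrite u1 mulr1.
  rewrite dotvBl dotvZl -sqr_norm2 u1 expr1n mulr1 => wq.
  have : `|q| <= `|dotv w u| + `|dotv w u - q|.
    by rewrite -[X in `|X| <= _](subKr (dotv w u)) ler_normB.
  by lra.
have w_le : norm2 w <= `|q| + 2 * L.
  rewrite wE; apply: le_trans (norm2D _ _) _.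
  by rewrite norm2Z u1 mulr1 lerD2l.
have w_ge : `|dotv w u| <= norm2 w.
  by apply: le_trans (cauchy_schwarz _ _) _; rewrite u1 mulr1.
have qL : 2 * L < `|q| by apply: lt_le_trans zv; rewrite ltr_pM2r //; lra.
have w_gt0 : 0 < norm2 w by lra.
rewrite /normalize dotvZl normrM ger0_norm ?invr_ge0 ?norm2_ge0 // [leRHS]mulrC.
rewrite ler_pdivlMr //.
have M0 : 0 < M by lra.
have k0 : 0 <= 1 - 4 / M by rewrite subr_ge0 ler_pdivrMr // mul1r ltW.
apply: le_trans (ler_wpM2l k0 w_le) _; apply: le_trans wu.
have : 4 * L <= 4 / M * (`|q| + 2 * L).
  by rewrite mulrAC ler_pdivlMr // -mulrA ler_pM2l //; lra.
by lra.
Qed.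

(** The old loading vanishes off the support and has norm at most one, so
    [score_signal] gives its score [v] a signal [|<z, v>|] of at least
    [M * lambda * K - 2 * lambda * K], which is what [loading_cos] asks for. *)
Lemma updated_loading_cos (v1 : 'cV[R]_n) (j : 'I_n) (M : R) :
  norm2 v1 = 1 -> 4 < M ->
  1 / 2 <= `|dotv (rspca_loading h lambda X v1) u| ->
  2 * M * (lambda * K) <= `|dotv (col j X) u| ->
  1 - 4 / M <= `|dotv (rspca_loading h lambda X
     (rspca_score X (rspca_loading h lambda X v1))) u|.
Proof.
move=> v11 M4 c_ge z_ge.
have L0 : 0 < lambda * K by rewrite mulr_gt0.
set p := rspca_loading h lambda X v1 in c_ge *.
have p1 : norm2 p <= 1 by exact: norm2_normalize_le1.
have p_off i : ~~ S i -> p i 0 = 0.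
  by move=> Si; rewrite 2!mxE thr_off_support ?mulr0 // v11.
have z_gt : 4 * (lambda * K) < `|dotv (col j X) u|.
  by apply: lt_le_trans z_ge; rewrite ltr_pM2r //; lra.
have [s1 zs] := score_signal p1 p_off c_ge z_gt.
apply: loading_cos => //; first by rewrite s1.
by apply: le_trans zs; lra.
Qed.

End Deterministic.

(** * Gaussian tail and small-ball estimates *)

Section LevelSets.
Variables (R : realType) (disp : measure_display) (T : measurableType disp).
Variables (f : T -> R) (t : R).
Hypothesis mf : measurable_fun setT f.

Lemma measurable_gt_set : measurable [set w | t < f w].
Proof.
rewrite -preimage_itvoy -[X in measurable X]setTI.
by apply: mf => //; exact: measurable_itv.
Qed.

Lemma measurable_lt_set : measurable [set w | f w < t].
Proof.
rewrite -preimage_itvNyo -[X in measurable X]setTI.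
by apply: mf => //; exact: measurable_itv.
Qed.

Lemma measurable_le_set : measurable [set w | f w <= t].
Proof.
rewrite -preimage_itvNyc -[X in measurable X]setTI.
by apply: mf => //; exact: measurable_itv.
Qed.

End LevelSets.

Section Gaussian.
Variable R : realType.
Implicit Types s t m : R.

Lemma measurable_tail_set t : measurable [set y : R | t < `|y|].
Proof. by apply: measurable_gt_set; exact: normr_measurable. Qed.

Lemma measurable_ball_set t : measurable [set y : R | `|y| < t].
Proof. by apply: measurable_lt_set; exact: normr_measurable. Qed.

Lemma normal_pdf_tail_le s t y : s != 0 -> 0 <= t -> t <= `|y| ->
  normal_pdf 0 s y <=
  Num.sqrt 2 * expR (- (t ^+ 2 / (4 * s ^+ 2))) *
  normal_pdf 0 (Num.sqrt 2 * s) y.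
Proof.
move=> s0 t0 ty.
have s2 : 0 < s ^+ 2 by rewrite exprn_even_gt0.
have r2 : Num.sqrt 2 ^+ 2 = 2 :> R by rewrite sqr_sqrtr.
have r0 : 0 < Num.sqrt 2 :> R by rewrite sqrtr_gt0.
rewrite !normal_pdfE ?mulf_neq0 ?s0 ?(gt_eqF r0) //=.
rewrite /normal_peak exprMn r2.
have -> : Num.sqrt (2 * s ^+ 2 * pi *+ 2) =
          Num.sqrt 2 * Num.sqrt (s ^+ 2 * pi *+ 2) :> R.
  by rewrite -sqrtrM //; congr (Num.sqrt _); ring.
set P := Num.sqrt (_ *+ 2); set E := expR _; set F := normal_fun 0 (_ * _) y.
have -> : Num.sqrt 2 * E * ((Num.sqrt 2 * P)^-1 * F) = P^-1 * (E * F).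
  have P0 : P != 0.
    by rewrite gt_eqF // sqrtr_gt0 mulrn_wgt0 // mulr_gt0 ?pi_gt0.
  by field; rewrite P0 gt_eqF.
rewrite {}/P {}/E {}/F ler_wpM2l ?invr_ge0 ?sqrtr_ge0 // /normal_fun.
rewrite -expRD ler_expR subr0.
rewrite exprMn r2.
have ty2 : t ^+ 2 <= y ^+ 2.
  by rewrite -(real_normK (num_real y)) ler_pXn2r ?nnegrE.
have -> : - y ^+ 2 / (s ^+ 2 *+ 2) =
  - (y ^+ 2 / (4 * s ^+ 2)) + - y ^+ 2 / (2 * s ^+ 2 *+ 2).
  by field.
by rewrite lerD2r lerN2 ler_pM2r // invr_gt0 mulr_gt0.
Qed.

(** Half of the exponent is given up so that the other half is still an
    integrable Gaussian density, of twice the variance. *)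
Lemma gauss_law_tail s t m : 0 < t -> s ^+ 2 <= m -> 0 < m ->
  (gauss_law 0 s [set y | (t < `|y|)%R] <=
   (Num.sqrt 2 * expR (- (t ^+ 2 / (4 * m))))%:E)%E.
Proof.
move=> t0 sm m0; rewrite /gauss_law; case: eqVneq => [_|s0].
  rewrite diracE memNset ?lee_fin ?mulr_ge0 ?sqrtr_ge0 ?expR_ge0 //=.
  by rewrite normr0 => /(lt_trans t0); rewrite ltxx.
have s2 : 0 < s ^+ 2 by rewrite exprn_even_gt0.
set c := Num.sqrt 2 * expR (- (t ^+ 2 / (4 * s ^+ 2))).
have c0 : 0 <= c by rewrite mulr_ge0 ?sqrtr_ge0 ?expR_ge0.
apply: (@le_trans _ _ c%:E); last first.
  rewrite lee_fin ler_wpM2l ?sqrtr_ge0 // ler_expR lerN2.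
  rewrite ler_wpM2l ?sqr_ge0 //.
  have pos4 r : 0 < r -> 0 < 4 * r by move=> r0; rewrite pmulr_rgt0.
  by rewrite lef_pV2 ?posrE; [rewrite ler_pM2l|exact: pos4|exact: pos4].
set sg := Num.sqrt 2 * s.
have mpdf r D : measurable_fun D (fun x : R => (normal_pdf 0 r x)%:E).
  apply/measurable_EFinP; apply: measurable_funTS.
  exact: measurable_normal_pdf.
have mcpdf D : measurable_fun D
    (fun x : R => (c%:E * (normal_pdf 0 sg x)%:E)%E).
  by apply: measurable_funeM; exact: mpdf.
have -> : c%:E = (\int[lebesgue_measure]_x (c%:E * (normal_pdf 0 sg x)%:E))%E.
  rewrite ge0_integralZl ?lee_fin //; last 2 first.
  - exact: mpdf.
  - by move=> x _; rewrite lee_fin normal_pdf_ge0.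
  by rewrite integral_normal_pdf mule1.
have pos x : (0 <= c%:E * (normal_pdf 0 sg x)%:E)%E.
  by rewrite -EFinM lee_fin mulr_ge0 ?normal_pdf_ge0.
apply: (@le_trans _ _ (\int[lebesgue_measure]_(x in [set y : R | (t < `|y|)%R])
                    (c%:E * (normal_pdf 0 sg x)%:E))%E); last first.
  apply: ge0_subset_integral => //; [exact: measurable_tail_set|exact: mcpdf].
apply: ge0_le_integral => //; first exact: measurable_tail_set.
- by move=> x _; rewrite lee_fin normal_pdf_ge0.
- exact: mpdf.
- exact: mcpdf.
- move=> x /= /ltW tx; rewrite -EFinM lee_fin.
  exact: normal_pdf_tail_le (ltW t0) tx.
Qed.

(** The density is at most [1 / (s * sqrt (2 pi))], which is at most [1 / s]. *)
Lemma gauss_law_ball s t : 0 < s -> 0 < t ->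
  (gauss_law 0 s [set y | (`|y| < t)%R] <= (2 * t / s)%:E)%E.
Proof.
move=> s0 t0; rewrite /gauss_law gt_eqF //.
apply: (@le_trans _ _ (\int[lebesgue_measure]_(x in [set y : R | (`|y| < t)%R])
                    (s^-1)%:E)%E).
  apply: ge0_le_integral => //; first exact: measurable_ball_set.
  - by move=> x _; rewrite lee_fin normal_pdf_ge0.
  - apply/measurable_EFinP; apply: measurable_funTS.
    exact: measurable_normal_pdf.
  - move=> x _; rewrite lee_fin (le_trans (normal_pdf_ub _ _ _)) ?gt_eqF //.
    rewrite /normal_peak lef_pV2 ?posrE ?sqrtr_gt0 //; last first.
      by rewrite mulrn_wgt0 // mulr_gt0 ?pi_gt0 ?exprn_gt0.
    rewrite -{1}(gtr0_norm s0) -sqrtr_sqr.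
    rewrite ler_wsqrtr // -mulrnAr ler_peMr ?sqr_ge0 //.
    by have := pi_ge2 R; lra.
rewrite integral_cst; last exact: measurable_ball_set.
have mu_ball : lebesgue_measure [set y : R | (`|y| < t)%R] = (2 * t)%:E.
  have -> : [set y : R | `|y| < t] = [set` `]- t, t[%R].
    by apply/seteqP; split => y /=; rewrite in_itv /= ltr_norml.
  rewrite lebesgue_measure_itv /= lte_fin ifT; last by lra.
  by rewrite -EFinB; congr (_%:E); ring.
by rewrite [X in (_ * X)%E]mu_ball -EFinM lee_fin mulrC.
Qed.

End Gaussian.

(** * Orders of magnitude as the dimension grows *)

Section Asymptotics.
Variable R : realType.
Implicit Types (a b : nat -> R) (p c : R).

Lemma limn_esup_lt_near a c :
  (limn_esup (fun d => (a d)%:E) < c%:E)%E -> \forall d \near \oo, a d <= c.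
Proof.
move=> /ereal_inf_lt [_ [V Voo <-]] supV.
apply: filterS Voo => d Vd; rewrite -lee_fin.
apply: le_trans (ltW supV); apply: ereal_sup_ubound.
by exists d.
Qed.

Lemma same_order_ub a b : same_order a b -> (\forall d \near \oo, 0 < b d) ->
  exists2 c, 0 < c & \forall d \near \oo, a d <= c * b d.
Proof.
move=> [c1 [c2 [c10 c12 _ sup_le]]] b0; exists (c2 + 1); first by lra.
have : (limn_esup (fun d => (a d / b d)%:E) < (c2 + 1)%:E)%E.
  by apply: le_lt_trans sup_le _; rewrite lte_fin; lra.
move=> /limn_esup_lt_near; apply: filterS2 b0 => d bd.
by rewrite ler_pdivrMr.
Qed.

Lemma same_order_lb a b : same_order a b -> (\forall d \near \oo, 0 < b d) ->
  exists2 c, 0 < c & \forall d \near \oo, c * b d <= a d.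
Proof.
move=> [c1 [c2 [c10 c12 inf_ge _]]] b0; exists (c1 / 2); first by lra.
have : (limn_esup (fun d => (- (a d / b d))%:E) < (- (c1 / 2))%:E)%E.
  move: inf_ge; rewrite /limn_einf leeNr => /le_lt_trans; apply.
  by rewrite -EFinN lte_fin; lra.
move=> /limn_esup_lt_near; apply: filterS2 b0 => d bd.
by rewrite lerN2 ler_pdivlMr.
Qed.

Lemma near_nat_ge c : \forall d \near \oo, c <= (d%:R : R).
Proof.
exists (Num.truncn c).+1 => // d /= cd.
apply: le_trans (ltW (truncnS_gt c)) _.
by rewrite ler_nat.
Qed.

Lemma near_ln_ge c : \forall d \near \oo, c <= ln (d%:R : R).
Proof.
apply: filterS (near_nat_ge (expR c)) => d cd.
rewrite -[leLHS]expRK ler_ln // posrE ?expR_gt0 //.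
exact: lt_le_trans (expR_gt0 c) cd.
Qed.

Lemma near_powR_ge a p c : 0 < p ->
  (forall c', \forall d \near \oo, c' <= a d) ->
  \forall d \near \oo, c <= a d `^ p.
Proof.
move=> p0 a_ge; apply: filterS (a_ge (`|c| `^ p^-1)) => d ad.
apply: le_trans (ler_norm c) _.
rewrite -[leLHS](@powRr1 _ `|c|) // -(@mulVf _ p) ?gt_eqF // powRrM.
apply: ge0_ler_powR; rewrite ?nnegrE ?powR_ge0 ?(ltW p0) //.
exact: le_trans (powR_ge0 _ _) ad.
Qed.

Lemma near_natR_gt0 : \forall d \near \oo, 0 < (d%:R : R).
Proof. by exists 1%N => // d /= d0; rewrite ltr0n. Qed.

Lemma near_natR_powR_gt0 p : \forall d \near \oo, 0 < (d%:R : R) `^ p.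
Proof. by apply: filterS near_natR_gt0 => d; exact: powR_gt0. Qed.

(** Since [2 * delta > 1], the tail exponent [c (ln d)^(2 delta)] eventually
    exceeds [2 ln d], so a union bound over [d] coordinates costs at most
    [d * d^(-2)]. *)
Lemma near_union_tail_le (delta c : R) : 1 / 2 < delta -> 0 < c ->
  \forall d \near \oo,
    d%:R * expR (- (c * (ln d%:R `^ delta) ^+ 2)) <= (d%:R^-1 : R).
Proof.
move=> delta_gt c0.
have p0 : 0 < 2 * delta - 1 by lra.
near=> d.
have d0 : 0 < d%:R :> R by near: d; exact: near_natR_gt0.
have ln1 : 1 <= ln (d%:R : R) by near: d; exact: near_ln_ge.
have lnp : 2 / c <= ln (d%:R : R) `^ (2 * delta - 1).
  by near: d; apply: near_powR_ge => // c'; exact: near_ln_ge.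
have ln_sq : (ln (d%:R : R) `^ delta) ^+ 2 =
             ln (d%:R : R) * ln (d%:R : R) `^ (2 * delta - 1).
  rewrite -powR_mulrn ?powR_ge0 // -powRrM mulr_powRB1; last 2 first.
  - by apply: le_trans ln1.
  - by lra.
  by rewrite mulrC.
have : 2 * ln (d%:R : R) <= c * (ln d%:R `^ delta) ^+ 2.
  rewrite ln_sq mulrCA -ler_pdivrMl; last by lra.
  by rewrite mulrCA mulVf ?mulr1 -?ler_pdivrMl // ?gt_eqF //; lra.
move=> ln_le; apply: (@le_trans _ _ (d%:R * expR (- (2 * ln d%:R)))).
  by rewrite ler_wpM2l ?ler0n // ler_expR lerN2.
by rewrite expRN expRM_natl lnK ?posrE // expr2 invfM mulrA divff
  ?mul1r // gt_eqF.
Unshelve. all: by end_near. Qed.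

Lemma cvg0_of_near_le a : (\forall d \near \oo, 0 <= a d) ->
  (forall e, 0 < e -> \forall d \near \oo, a d <= e) -> a @ \oo --> 0.
Proof.
move=> a0 a_le; apply/cvgr0Pnorm_le => e e0.
by apply: filterS2 a0 (a_le e e0) => d ad; rewrite ger0_norm.
Qed.

Lemma cvg_natR_powRN p c : 0 < p -> 0 <= c ->
  (fun d => c * (d%:R : R) `^ (- p)) @ \oo --> 0.
Proof.
move=> p0 c0; apply: cvg0_of_near_le.
  by apply: nearW => d; rewrite mulr_ge0 ?powR_ge0.
move=> e e0; have := near_powR_ge (c / e) p0 near_nat_ge.
apply: filterS2 (near_natR_powR_gt0 p) => d dp.
by rewrite powRN ler_pdivrMr // mulrC -ler_pdivrMr.
Qed.

End Asymptotics.

(** * Measurability of scores and loadings *)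

Section Measurability.
Variables (R : realType) (disp : measure_display) (T : measurableType disp).
Variable d : nat.
Implicit Types Y : T -> 'cV[R]_d.

Lemma measurable_dotv Y (y : 'cV[R]_d) :
  random_vector Y -> measurable_fun setT (fun w => dotv (Y w) y).
Proof.
by move=> mY; apply: measurable_sum => i; apply: measurable_funM.
Qed.

(** The inverse norm is the power [-1/2] of the squared norm, also at the zero
    vector. *)
Lemma random_vector_normalize Y :
  random_vector Y -> random_vector (fun w => normalize (Y w)).
Proof.
move=> mY i.
have -> : (fun w => normalize (Y w) i 0) =
    (fun w => dotv (Y w) (Y w) `^ (- 2^-1) * Y w i 0).
  by apply/funext => w; rewrite mxE powRN powR12_sqrt // dotv_ge0.
apply: measurable_funM => //.
apply: (measurableT_comp (measurable_powR _)).
by apply: measurable_sum => k; apply: measurable_funM.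
Qed.

End Measurability.

Section MeasurabilityProducts.
Variables (R : realType) (disp : measure_display) (T : measurableType disp).
Variables (d n : nat) (X : T -> 'M[R]_(d, n)).
Hypothesis mX : forall i j, measurable_fun setT (fun w => X w i j).

Lemma random_vector_score (p : T -> 'cV[R]_d) :
  random_vector p -> random_vector (fun w => rspca_score (X w) (p w)).
Proof.
move=> mp; apply: random_vector_normalize => j.
rewrite [X in measurable_fun _ X](_ : _ =
    fun w => \sum_i X w i j * p w i 0); last first.
  by apply/funext => w; rewrite mxE; apply: eq_bigr => i _; rewrite mxE.
by apply: measurable_sum => i; apply: measurable_funM.
Qed.

Lemma random_vector_loading (h : R -> R -> R) l (v : T -> 'cV[R]_n) :
  thresholding h -> random_vector v ->
  random_vector (fun w => rspca_loading h l (X w) (v w)).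
Proof.
move=> hh mv; apply: random_vector_normalize => i.
rewrite [X in measurable_fun _ X](_ : _ =
    h l \o (fun w => \sum_j X w i j * v w j 0)); last first.
  by apply/funext => w; rewrite /= !mxE.
apply: measurableT_comp; first exact: measurable_thr.
by apply: measurable_sum => j; apply: measurable_funM.
Qed.

End MeasurabilityProducts.

(** * Probability of the bad events in a fixed dimension *)

Section FiniteUnion.
Variables (R : realType) (disp : measure_display) (T : measurableType disp).
Variables (P : probability T R) (I : finType) (A : I -> set T) (c : R).
Hypotheses (mA : forall i, measurable (A i)).

Lemma exists_setE : [set w | exists i, A i w] =
  \big[setU/set0]_(i <- enum I) A i.
Proof.
rewrite -bigcup_seq; apply/seteqP; split => w /=.
  by move=> [i Ai]; exists i => //=; rewrite mem_enum.
by move=> [i _ Ai]; exists i.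
Qed.

Lemma measurable_exists : measurable [set w | exists i, A i w].
Proof. by rewrite exists_setE; apply: bigsetU_measurable. Qed.

Lemma prob_exists_le : (forall i, (P (A i) <= c%:E)%E) ->
  (P [set w | exists i, A i w] <= (#|I|%:R * c)%:E)%E.
Proof.
move=> Ac; rewrite exists_setE cardE; elim: (enum I) => [|i s IH].
  by rewrite big_nil measure0 mul0r.
rewrite big_cons; apply: le_trans (measureU2 _ _ _) _ => //.
  exact: bigsetU_measurable.
by rewrite /= -natr1 mulrDl mul1r addrC EFinD leeD.
Qed.

End FiniteUnion.

Section GaussianData.
Variables (R : realType) (disp : measure_display) (T : measurableType disp).
Variables (P : probability T R) (d : nat) (S : 'M[R]_d).
Variables (lam : nat -> R) (u : nat -> 'cV[R]_d).
Hypotheses (hS : ordered_eigensystem S lam u) (d0 : (0 < d)%N).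
Variable (Y : T -> 'cV[R]_d).
Hypothesis hY : mvnormal P Y 0 S.

Lemma dotv0 (a : 'cV[R]_d) : dotv a 0 = 0.
Proof. by apply: big1 => i _; rewrite mxE mulr0. Qed.

(** The residual is the linear functional [<b, Y>] with [b = e_i - u_(i,1) u_1],
    a vector of norm at most one orthogonal to [u_1], so its variance is at most
    [lam 2]. *)
Lemma residual_tail i t m : 0 < t -> 0 < m -> lam 2 <= m ->
  (P [set w | (t < `|residual (u 1) (Y w) i|)%R] <=
   (Num.sqrt 2 * expR (- (t ^+ 2 / (4 * m))))%:E)%E.
Proof.
move=> t0 m0 lam2; have [_ _ S_psd lawY] := hY.
pose e : 'cV[R]_d := delta_mx i 0.
have dot_e y : dotv e y = y i 0.
  rewrite /dotv (bigD1 i) //= !mxE !eqxx mul1r big1 ?addr0 // => k ki.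
  by rewrite !mxE (negbTE ki) mul0r.
pose b := e - u 1 i 0 *: u 1.
have u11 : dotv (u 1) (u 1) = 1.
  by rewrite -sqr_norm2 (norm2_eigenvector1 hS d0) expr1n.
have bu : dotv b (u 1) = 0 by rewrite dotvBl dotvZl u11 dot_e mulr1 subrr.
have bb : dotv b b <= 1.
  rewrite {2}/b dotvBr dotvZr bu mulr0 subr0 dotvC dot_e !mxE !eqxx.
  by rewrite lerBlDr lerDl -expr2 sqr_ge0.
have resE w : residual (u 1) (Y w) i = dotv b (Y w).
  by rewrite dotvBl dotvZl dot_e (dotvC (u 1)).
rewrite [X in P X](_ : _ = (fun w => dotv b (Y w)) @^-1` [set y | t < `|y|]);
  last first.
  by apply/seteqP; split => w /=; rewrite resE.
rewrite lawY ?dotv0; last exact: measurable_tail_set.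
apply: gauss_law_tail => //.
rewrite sqr_sqrtr //; apply: (quadratic_form_orth_le hS) => //.
exact: ltW.
Qed.

Lemma signal_ball t : 0 < t -> 0 < lam 1 ->
  (P [set w | (`|dotv (Y w) (u 1)| < t)%R] <= (2 * t / Num.sqrt (lam 1))%:E)%E.
Proof.
move=> t0 lam0; have [_ _ _ lawY] := hY; have [_ eigen _] := hS.
rewrite [X in P X](_ : _ = (fun w => dotv (u 1) (Y w)) @^-1` [set y | `|y| < t]);
  last first.
  by apply/seteqP; split => w /=; rewrite dotvC.
rewrite lawY ?dotv0; last exact: measurable_ball_set.
rewrite eigen ?d0 // dotvZr -sqr_norm2 (norm2_eigenvector1 hS d0) expr1n mulr1.
by apply: gauss_law_ball => //; rewrite sqrtr_gt0.
Qed.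

End GaussianData.

Section OneDimension.
Variables (R : realType) (disp : measure_display) (T : measurableType disp).
Variables (P : probability T R) (d n : nat) (Sigma : 'M[R]_d).
Variables (lam : nat -> R) (u : nat -> 'cV[R]_d) (X : T -> 'M[R]_(d, n)).
Variables (h : R -> R -> R) (lambda K m M : R) (S : pred 'I_d).
Variables (v1 : T -> 'cV[R]_n).
Hypotheses (hSigma : ordered_eigensystem Sigma lam u).
Hypotheses (d0 : (0 < d)%N) (n0 : (0 < n)%N).
Hypothesis hX : forall j, mvnormal P (fun w => col j (X w)) 0 Sigma.
Hypotheses (hh : thresholding h) (lambda0 : 0 < lambda) (K0 : 0 < K).
Hypotheses (m0 : 0 < m) (lam2 : lam 2 <= m) (lam1 : 0 < lam 1) (M4 : 4 < M).
Hypotheses (u_off : forall i, ~~ S i -> u 1 i 0 = 0).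
Hypotheses (u_on : forall i, S i -> 1 <= K * `|u 1 i 0|).
Hypotheses (mv1 : random_vector v1) (v11 : forall w, norm2 (v1 w) = 1).

Let u_old w := rspca_loading h lambda (X w) (v1 w).
Let u_new w := rspca_loading h lambda (X w) (rspca_score (X w) (u_old w)).

Lemma measurable_data i j : measurable_fun setT (fun w => X w i j).
Proof.
have [mcol _ _ _] := hX j; have := mcol i.
by congr measurable_fun; apply/funext => w; rewrite mxE.
Qed.

Lemma random_vector_old : random_vector u_old.
Proof. by apply: random_vector_loading => //; exact: measurable_data. Qed.

Lemma random_vector_new : random_vector u_new.
Proof.
apply: random_vector_loading => //; first exact: measurable_data.
apply: random_vector_score; first exact: measurable_data.
exact: random_vector_old.
Qed.

(** The updated loading can only be far from [u_1] if some noise coordinate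
    exceeds [lambda / n], or the signal of the first observation is small, or the
    old loading is nearly orthogonal to [u_1]. *)
Lemma prob_loading_cos_lt :
  (P [set w | (`|dotv (u_new w) (u 1)| < 1 - 4 / M)%R] <=
   (n%:R * Num.sqrt 2 *
      (d%:R * expR (- ((lambda / n%:R) ^+ 2 / (4 * m)))) +
    4 * M * (lambda * K) / Num.sqrt (lam 1))%:E +
   P [set w | (`|dotv (u_old w) (u 1)| < 1 / 2)%R])%E.
Proof.
pose j0 := Ordinal n0.
pose E1 := [set w | exists ij : 'I_d * 'I_n,
  lambda / n%:R < `|residual (u 1) (col ij.2 (X w)) ij.1|].
pose E2 := [set w | `|dotv (col j0 (X w)) (u 1)| < 2 * M * (lambda * K)].
pose E3 := [set w | `|dotv (u_old w) (u 1)| < 1 / 2].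
have mcol j : random_vector (fun w => col j (X w)) by have [] := hX j.
have mabs Y : random_vector Y ->
    measurable_fun setT (fun w : T => `|dotv (Y w) (u 1)|).
  by move=> mY; apply: measurableT_comp => //; exact: measurable_dotv.
have mtail (ij : 'I_d * 'I_n) : measurable
    [set w | lambda / n%:R < `|residual (u 1) (col ij.2 (X w)) ij.1|].
  apply: measurable_gt_set; apply: measurableT_comp => //.
  apply: measurable_funB; first exact: mcol.
  by apply: measurable_funM => //; apply: measurable_dotv; exact: mcol.
have mE1 : measurable E1 by exact: measurable_exists.
have mE2 : measurable E2 by apply: measurable_lt_set; apply: mabs; exact: mcol.
have mE3 : measurable E3.
  by apply: measurable_lt_set; apply: mabs; exact: random_vector_old.
have PE1 : (P E1 <= (n%:R * Num.sqrt 2 *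
      (d%:R * expR (- ((lambda / n%:R) ^+ 2 / (4 * m)))))%:E)%E.
  apply: le_trans (prob_exists_le mtail _) _.
    move=> ij; apply: (residual_tail hSigma d0 (hX ij.2) ij.1 _ m0 lam2).
    by rewrite divr_gt0 ?ltr0n.
  rewrite card_prod !card_ord natrM lee_fin le_eqVlt; apply/orP; left.
  by apply/eqP; ring.
have PE2 : (P E2 <= (4 * M * (lambda * K) / Num.sqrt (lam 1))%:E)%E.
  apply: le_trans (signal_ball hSigma d0 (hX j0) _ lam1) _.
    by rewrite !mulr_gt0 // (lt_trans _ M4).
  by rewrite lee_fin le_eqVlt; apply/orP; left; apply/eqP; ring.
apply: (@le_trans _ _ (P (E1 `|` E2 `|` E3))); last first.
  apply: le_trans (measureU2 _ (measurableU _ _ mE1 mE2) mE3) _.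
  rewrite EFinD leeD2r //.
  by apply: le_trans (measureU2 _ mE1 mE2) _; exact: leeD.
apply: le_measure; rewrite ?inE.
- by apply: measurable_lt_set; apply: mabs; exact: random_vector_new.
- by apply: measurableU => //; exact: measurableU.
move=> w /= cos_lt; apply: contrapT => /not_orP [/not_orP [nE1 nE2] nE3].
move: cos_lt; apply/negP; rewrite -leNgt.
apply: (@updated_loading_cos _ _ _ _ _ K _ _ S hh lambda0 n0
  (norm2_eigenvector1 hSigma d0) u_off u_on K0 _ _ j0) => //.
- move=> i j; rewrite leNgt; apply/negP => tail.
  by apply: nE1; exists (i, j).
- by rewrite leNgt; apply/negP.
- by rewrite leNgt; apply/negP.
Qed.

End OneDimension.

(** * Consistency in the limit *)

Section ConvergenceInProbability.
Variables (R : realType) (disp : nat -> measure_display).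
Variables (T : forall d, measurableType (disp d)).
Variables (P : forall d, probability (T d) R).

Lemma prob_cvg0_le (A : forall d, set (T d)) (b : nat -> \bar R) :
  (\forall d \near \oo, (P d (A d) <= b d)%E) -> b @ \oo --> 0%E ->
  (fun d => P d (A d)) @ \oo --> 0%E.
Proof.
move=> Ab b0; apply: (squeeze_cvge _ (cvg_cst 0%E) b0).
by apply: filterS Ab => d ->; rewrite measure_ge0.
Qed.

(** As the cosine decreases on [[0, pi]], an angle at least [e] means a cosine at
    most [cos e < 1]; for [e > pi] the event is empty. *)
Lemma acos_cvg_in_prob (Y : forall d, T d -> R) :
  (forall d, measurable_fun setT (Y d)) ->
  (forall d w, 0 <= Y d w <= 1) ->
  (forall k, k < 1 -> (fun d => P d [set w | Y d w < k]) @ \oo --> 0%E) ->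
  cvg_in_prob P (fun d w => acos (Y d w)) 0.
Proof.
move=> mY Y01 Yk e e0.
have Y11 d w : -1 <= Y d w <= 1 by have := Y01 d w; lra.
have [e_pi|pi_e] := leP e pi; last first.
  apply: (@prob_cvg0_le _ (fun=> 0%E)); last exact: cvg_cst.
  apply: nearW => d; rewrite [X in P d X](_ : _ = set0) ?measure0 //.
  apply/seteqP; split => w //=; apply/negP; rewrite -ltNge subr0.
  by rewrite ger0_norm ?acos_ge0 // (le_lt_trans _ pi_e) ?acos_lepi.
have cos_e : cos e < 1.
  by rewrite -cos0 ltr_cos // in_itv /= ?lexx ?pi_ge0 ?e_pi ?(ltW e0).
have k1 : (1 + cos e) / 2 < 1 by lra.
apply: prob_cvg0_le (Yk _ k1); apply: nearW => d.
rewrite [X in (P d X <= _)%E](_ : _ = [set w | Y d w <= cos e]); last first.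
  have acosE w : (e <= acos (Y d w)) = (Y d w <= cos e).
    have [acosP cos_acos] := acos_def (Y11 d w).
    by rewrite -[in RHS]cos_acos !leNgt ltr_cos // in_itv /= ?e_pi ?(ltW e0).
  by apply/seteqP; split => w /=; rewrite subr0 ger0_norm ?acos_ge0 // acosE.
apply: le_measure; rewrite ?inE.
- exact: measurable_le_set.
- exact: measurable_lt_set.
- by move=> w /=; lra.
Qed.

End ConvergenceInProbability.

Theorem theorem3p4 (R : realType) (n : nat) (hn : (1 <= n)%N)
  (beta alpha theta C eta delta gamma varsigma : R)
  (hbeta : 0 <= beta <= 1)
  (* one probability space, one covariance matrix, one sample per dimension *)
  (disp : nat -> measure_display) (T : forall d, measurableType (disp d))
  (P : forall d, probability (T d) R)
  (Sigma : forall d, 'M[R]_d)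
  (lam : nat -> nat -> R) (u : forall d, nat -> 'cV[R]_d)
  (hSigma : forall d, ordered_eigensystem (Sigma d) (lam d) (u d))
  (X : forall d, T d -> 'M[R]_(d, n))
  (hX : forall d,
     iid_mvnormal (P d) (fun (j : 'I_n) w => col j (X d w)) 0 (Sigma d))
  (hu1 : forall d (i : 'I_d),
     ((i < supp_size beta d)%N -> u d 1%N i 0 != 0) /\
     (~~ (i < supp_size beta d)%N -> u d 1%N i 0 = 0))
  (* (a) *)
  (ha1 : same_order (fun d => lam d 1%N) (fun d => d%:R `^ alpha))
  (ha2 : same_order (fun d => lam d 2%N) (fun d => d%:R `^ theta))
  (ha3 : same_order (fun d => \sum_(2 <= i < d.+1) lam d i) (fun d => d%:R))
  (htheta : 0 <= theta < alpha) (halpha : 0 < alpha <= 1)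
  (* (b) *)
  (hC : 0 <= C)
  (hb1 : limn_esup
     (fun d => (lam d 1%N / \sum_(2 <= i < d.+1) lam d i)%:E) = C%:E)
  (hb2 : (fun d => (\sum_(1 <= i < d.+1) lam d i ^+ 2) /
                   (\sum_(1 <= i < d.+1) lam d i) ^+ 2) @ \oo --> 0)
  (* (c) *)
  (hc : same_order
     (fun d => \big[Num.max/0]_(i < d | (i < supp_size beta d)%N)
                 `|u d 1%N i 0|^-1)
     (fun d => d%:R `^ (eta / 2)))
  (heta : 0 <= eta < alpha)
  (* (d) *)
  (Delta : forall d, 'M[R]_d) (rho : nat -> R)
  (hDelta : forall d,
     iid_mvnormal (P d) (fun (j : 'I_n) w => noise_part (u d) (X d w) j)
       0 (Delta d))
  (hmix : forall d (k l : 'I_d), k != l ->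
     (k < supp_size beta d)%N -> (l < supp_size beta d)%N ->
     `|Delta d k l| <=
       Num.sqrt (Delta d k k) * Num.sqrt (Delta d l l) * rho `|k - l|%N)
  (hrho1 : forall t : nat, (1 < t)%N -> rho t < 1)
  (hrho2 : (fun t : nat => rho t * ln t%:R) @ \oo --> 0)
  (* (e) *)
  (lambda : nat -> R)
  (hlambda : \forall d \near \oo,
     ln d%:R `^ delta * d%:R `^ (theta / 2) <= lambda d <= d%:R `^ (gamma / 2))
  (hdelta : 1 / 2 < delta) (hgamma : theta < gamma < alpha - eta)
  (h : R -> R -> R) (hh : thresholding h)
  (v1 : forall d, T d -> 'cV[R]_n)
  (hv1m : forall d, random_vector (v1 d))
  (hv1 : forall d w, top_right_singular_vector (X d w) (v1 d w))
  (u_old u_new : forall d, T d -> 'cV[R]_d) (v_new : forall d, T d -> 'cV[R]_n)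
  (hu_old : forall d w,
     u_old d w = rspca_loading h (lambda d) (X d w) (v1 d w))
  (hvarsigma : 1 - alpha <= varsigma)
  (hcons : little_op P (varsigma / 2)
     (fun d w => `|dotv (u_old d w) (u d 1%N)| - 1))
  (hv_new : forall d w, v_new d w = rspca_score (X d w) (u_old d w))
  (hu_new : forall d w,
     u_new d w = rspca_loading h (lambda d) (X d w) (v_new d w)) :
  cvg_in_prob P (fun d w => acos `|dotv (u_new d w) (u d 1%N)|) 0.
Proof.
have dn0 (p : R) := near_natR_powR_gt0 p.
have [c1 c1_gt0 lam1_ge] := same_order_lb ha1 (dn0 _).
have [c2 c2_gt0 lam2_le] := same_order_ub ha2 (dn0 _).
have [cK cK_gt0 K_le] := same_order_ub hc (dn0 _).
have hv11 d w : norm2 (v1 d w) = 1 by have [] := hv1 d w.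
have u_oldE d : u_old d = fun w => rspca_loading h (lambda d) (X d w) (v1 d w).
  by apply/funext => w; exact: hu_old.
have u_newE d : u_new d =
    fun w => rspca_loading h (lambda d) (X d w) (rspca_score (X d w) (u_old d w)).
  by apply/funext => w; rewrite hu_new hv_new.
have mu_old d : random_vector (u_old d).
  by rewrite u_oldE; apply: (random_vector_old (lambda d) (hX d).1 hh (hv1m d)).
have mu_new d : random_vector (u_new d).
  by rewrite u_newE u_oldE;
    apply: (random_vector_new (lambda d) (hX d).1 hh (hv1m d)).
have mabs d Y : random_vector Y ->
    measurable_fun setT (fun w : T d => `|dotv (Y w) (u d 1)|).
  by move=> mY; apply: measurableT_comp => //; exact: measurable_dotv.
(* as varsigma >= 1 - alpha >= 0, the rate assumption at least gives
   convergence to one *)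
have old_cvg : (fun d => P d [set w | `|dotv (u_old d w) (u d 1%N)| < 1 / 2])
    @ \oo --> 0%E.
  apply: prob_cvg0_le (hcons (1 / 2) _); last by lra.
  near=> d.
  have d1 : 1 <= d%:R :> R by near: d; exact: near_nat_ge.
  apply: le_measure; rewrite ?inE.
  - by apply: measurable_lt_set; exact: mabs.
  - rewrite [X in measurable X](_ : _ = ~` [set w |
        `|d%:R `^ (varsigma / 2) * (`|dotv (u_old d w) (u d 1)| - 1) - 0|
        < 1 / 2]); last first.
      by apply/seteqP; split => w /=; rewrite leNgt => /negP.
    apply: measurableC; apply: measurable_lt_set; apply: measurableT_comp => //.
    apply: measurable_funB => //; apply: measurable_funM => //.
    by apply: measurable_funB => //; exact: mabs.
  move=> w /= c_lt; rewrite subr0 normrM.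
  have pow1 : 1 <= `|d%:R `^ (varsigma / 2)| :> R.
    rewrite ger0_norm ?powR_ge0 // -[leLHS](@powRr0 _ d%:R);
    apply: ler_powR => //; lra.
  have dist : 1 / 2 <= `| `|dotv (u_old d w) (u d 1)| - 1| :> R.
    by rewrite ler0_norm; lra.
  by apply: le_trans dist _; rewrite ler_peMl.
apply: acos_cvg_in_prob => [d|d w|k k1]; first exact: mabs.
  rewrite normr_ge0 /=; case: (posnP d) => [d0|d0].
    rewrite /dotv big1 ?normr0 ?ler01 // => i _.
    by have := ltn_ord i; rewrite [X in (_ < X)%N]d0.
  apply: le_trans (cauchy_schwarz _ _) _.
  by rewrite (norm2_eigenvector1 (hSigma d) d0) mulr1 hu_new norm2_normalize_le1.
(* any M > 4 with k <= 1 - 4 / M would do *)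
pose M := 5 + 4 / (1 - k).
have k0 : 0 < 1 - k by lra.
have M4 : 4 < M by have : 0 < 4 / (1 - k) by [rewrite divr_gt0]; rewrite /M; lra.
have kM : k <= 1 - 4 / M.
  have : 4 / M <= 1 - k; last by lra.
  by rewrite ler_pdivrMr ?(lt_trans _ M4) // mulrC -ler_pdivrMr // /M; lra.
pose p := (alpha - gamma - eta) / 2.
have p0 : 0 < p by rewrite /p; lra.
pose b d := n%:R * Num.sqrt 2 * d%:R `^ (- 1) +
            4 * M * cK / Num.sqrt c1 * d%:R `^ (- p) : R.
have coef0 : 0 <= 4 * M * cK / Num.sqrt c1.
  rewrite !mulr_ge0 ?invr_ge0 ?sqrtr_ge0 ?(ltW cK_gt0) //.
  by rewrite ltW // (lt_trans _ M4).
have b_cvg : b @ \oo --> 0.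
  rewrite -[X in _ --> X]addr0; apply: cvgD; apply: cvg_natR_powRN => //.
apply: (@prob_cvg0_le _ _ _ _ _ (fun d => ((b d)%:E +
   P d [set w | (`|dotv (u_old d w) (u d 1%N)| < 1 / 2)%R])%E)); last first.
  rewrite -[X in _ --> X]adde0; apply: cvgeD => //.
  by apply: cvg_EFin => //; exact: nearW.
pose cd : R := (4 * n%:R ^+ 2 * c2)^-1.
have nR0 : 0 < n%:R :> R by rewrite ltr0n.
have cd0 : 0 < cd by rewrite invr_gt0 !mulr_gt0.
near=> d.
have d0 : 0 < d%:R :> R by near: d; exact: near_natR_gt0.
have ln1 : 1 <= ln (d%:R : R) by near: d; exact: near_ln_ge.
have /andP[lambda_ge lambda_le] : ln d%:R `^ delta * d%:R `^ (theta / 2)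
    <= lambda d <= d%:R `^ (gamma / 2) by near: d.
have lam1 : c1 * d%:R `^ alpha <= lam d 1%N by near: d.
have lam2 : lam d 2%N <= c2 * d%:R `^ theta by near: d.
have tail_le : d%:R * expR (- (cd * (ln d%:R `^ delta) ^+ 2)) <= d%:R^-1 :> R.
  by near: d; exact: near_union_tail_le.
have Kd : \big[Num.max/0]_(i < d | (i < supp_size beta d)%N) `|u d 1%N i 0|^-1
    <= cK * d%:R `^ (eta / 2) by near: d.
have sqr_powR_half (q : R) : (d%:R `^ (q / 2)) ^+ 2 = d%:R `^ q :> R.
  by rewrite -powR_mulrn ?powR_ge0 // -powRrM divfK.
have lambda0 : 0 < lambda d.
  by apply: lt_le_trans lambda_ge;
    rewrite mulr_gt0 ?powR_gt0 // (lt_le_trans _ ln1).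
have lam1_gt0 : 0 < lam d 1%N.
  by apply: lt_le_trans lam1; rewrite mulr_gt0 ?powR_gt0.
apply: (@le_trans _ _ (P d
    [set w | (`|dotv (u_new d w) (u d 1%N)| < 1 - 4 / M)%R])).
  apply: le_measure; rewrite ?inE.
  - by apply: measurable_lt_set; exact: mabs.
  - by apply: measurable_lt_set; exact: mabs.
  - by move=> w /= /lt_le_trans; apply.
rewrite u_newE u_oldE.
have K0 : 0 < cK * d%:R `^ (eta / 2) by rewrite mulr_gt0 ?powR_gt0.
have m0 : 0 < c2 * d%:R `^ theta by rewrite mulr_gt0 ?powR_gt0.
have dN : (0 < d)%N by rewrite -(ltr0n R).
apply: le_trans (@prob_loading_cos_lt _ _ _ (P d) d n (Sigma d) (lam d) (u d)
  (X d) h (lambda d) (cK * d%:R `^ (eta / 2)) (c2 * d%:R `^ theta) M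
  (fun i => (i < supp_size beta d)%N) (v1 d) (hSigma d) dN hn (hX d).1
  hh lambda0 K0 m0 lam2 lam1_gt0 M4 _ _ (hv1m d) (hv11 d)) _.
- by move=> i; apply: (hu1 d i).2.
- move=> i iS; have ui : 0 < `|u d 1%N i 0| by rewrite normr_gt0 (hu1 d i).1.
  rewrite -ler_pdivrMr // div1r; apply: le_trans Kd.
  exact: (@le_bigmax_cond _ _ _ _ _ _ (fun i => `|u d 1%N i 0|^-1)).
apply: leeD2r; rewrite lee_fin /b; apply: lerD.
  rewrite powR_inv1 ?ler0n // ler_wpM2l ?mulr_ge0 ?sqrtr_ge0 //.
  apply: le_trans tail_le; rewrite ler_wpM2l ?ler0n // ler_expR lerN2.
  (* the d^theta in lambda^2 cancels the one in the noise variance *)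
  have : (ln d%:R `^ delta * d%:R `^ (theta / 2)) ^+ 2 <= lambda d ^+ 2.
    by rewrite ler_pXn2r ?nnegrE ?mulr_ge0 ?powR_ge0 // ltW.
  rewrite exprMn sqr_powR_half => lambda_sq.
  have -> : (lambda d / n%:R) ^+ 2 / (4 * (c2 * d%:R `^ theta)) =
            cd * (lambda d ^+ 2 / d%:R `^ theta).
    by rewrite /cd; field; rewrite !gt_eqF ?powR_gt0.
  by rewrite ler_wpM2l ?(ltW cd0) // ler_pdivlMr ?powR_gt0.
have sqrt_lam : Num.sqrt c1 * d%:R `^ (alpha / 2) <= Num.sqrt (lam d 1%N).
  have -> : d%:R `^ (alpha / 2) = Num.sqrt (d%:R `^ alpha) :> R.
    by rewrite -powR12_sqrt ?powR_ge0 // -powRrM.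
  by rewrite -sqrtrM ?(ltW c1_gt0) // ler_wsqrtr.
rewrite ler_pdivrMr ?sqrtr_gt0 //.
apply: le_trans (ler_wpM2l (mulr_ge0 coef0 (powR_ge0 _ _)) sqrt_lam).
have powE : d%:R `^ (- p) * d%:R `^ (alpha / 2) =
            d%:R `^ (gamma / 2) * d%:R `^ (eta / 2) :> R.
  rewrite -!powRD ?(gt_eqF d0) ?implybT //; congr (_ `^ _).
  by rewrite /p; field.
have -> : 4 * M * cK / Num.sqrt c1 * d%:R `^ (- p) *
    (Num.sqrt c1 * d%:R `^ (alpha / 2)) =
    4 * M * cK * (d%:R `^ (- p) * d%:R `^ (alpha / 2)).
  by field; rewrite gt_eqF // sqrtr_gt0.
rewrite powE.
have -> : 4 * M * (lambda d * (cK * d%:R `^ (eta / 2))) =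
          4 * M * cK * (lambda d * d%:R `^ (eta / 2)) by ring.
rewrite ler_wpM2l ?ler_wpM2r ?powR_ge0 //.
by rewrite !mulr_ge0 ?(ltW cK_gt0) // ltW // (lt_trans _ M4).
Unshelve. all: by end_near. Qed.
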